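(* Let $\mathcal{P} \subset \mathbb{E}^n$ be a discrete point set and let $p \in \mathcal{P} \cap \partial \operatorname{conv}(\mathcal{P})$ be a boundary point of $\mathcal{P}$. If the direction cone $C(p)$ is finitely generated, then the Voronoi cell $V(p)$ is a polyhedron.
   Context: $\mathbb{E}^n$ is $n$-dimensional Euclidean space with Euclidean norm $\|\cdot\|$. A set $\mathcal{P} \subset \mathbb{E}^n$ is discrete if every bounded subset of $\mathbb{E}^n$ contains only finitely many points of $\mathcal{P}$. The Voronoi cell of $p \in \mathcal{P}$ relative to $\mathcal{P}$ is $V(p) := \{ x \in \mathbb{E}^n \mid \|x-p\| \le \|x-q\| \text{ for all } q \in \mathcal{P}\}$. $\operatorname{conv}(\mathcal{P})$ is the convex hull and $\partial M$ the boundary of a set $M$. The direction cone of $p$ is $C(p) := \operatorname{cone}(\mathcal{P}-p) = \{ \sum_{i=1}^m \lambda_i (p_i - p) \mid p_i \in \mathcal{P}, \lambda_i \ge 0, m \in \mathbb{N}\}$. A cone is finitely generated if it equals $\operatorname{cone}(v_1,\dots,v_k)$ for finitely many vectors $v_1,\dots,v_k$. A polyhedron is an intersection of finitely many closed half spaces of $\mathbb{E}^n$. *)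

(* Defs.v *)
From HB Require Import structures.
From mathcomp Require Import all_boot all_order all_algebra.
From mathcomp Require Import all_classical all_reals all_analysis.

Set Implicit Arguments.
Unset Strict Implicit.
Unset Printing Implicit Defensive.

Import Order.TTheory GRing.Theory Num.Theory.
Import numFieldNormedType.Exports.

Local Open Scope classical_set_scope.
Local Open Scope ring_scope.

(* The library's norm on 'rV[R]_n is the sup norm, so the Euclidean one is
   defined here; both induce the topology carried by 'rV[R]_n, which is the
   one used for [closure] and [interior] below. *)
Definition edot (R : realType) (n : nat) (x y : 'rV[R]_n) : R :=
  \sum_(i < n) x 0 i * y 0 i.

Definition enorm (R : realType) (n : nat) (x : 'rV[R]_n) : R :=
  Num.sqrt (edot x x).

Definition ebounded (R : realType) (n : nat) (B : set 'rV[R]_n) : Prop :=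
  exists M : R, forall x, B x -> enorm x <= M.

Definition discrete_point_set (R : realType) (n : nat)
    (P : set 'rV[R]_n) : Prop :=
  forall B : set 'rV[R]_n, ebounded B -> finite_set (P `&` B).

Definition voronoi_cell (R : realType) (n : nat) (P : set 'rV[R]_n)
    (p : 'rV[R]_n) : set 'rV[R]_n :=
  [set x | forall q, P q -> enorm (x - p) <= enorm (x - q)].

Definition convex_hull (R : realType) (n : nat)
    (P : set 'rV[R]_n) : set 'rV[R]_n :=
  smallest (fun A : set 'rV[R]_n => convex_set A) P.

Definition boundary (T : topologicalType) (A : set T) : set T :=
  closure A `\` interior A.

Definition cone (R : realType) (n : nat)
    (S : set 'rV[R]_n) : set 'rV[R]_n :=
  [set x | exists (m : nat) (v : 'I_m -> 'rV[R]_n) (lambda : 'I_m -> R),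
     [/\ forall i, S (v i), forall i, 0 <= lambda i
       & x = \sum_(i < m) lambda i *: v i]].

Definition direction_cone (R : realType) (n : nat) (P : set 'rV[R]_n)
    (p : 'rV[R]_n) : set 'rV[R]_n :=
  cone [set q - p | q in P].

Definition finitely_generated_cone (R : realType) (n : nat)
    (C : set 'rV[R]_n) : Prop :=
  exists (k : nat) (v : 'I_k -> 'rV[R]_n), C = cone (range v).

Definition closed_half_space (R : realType) (n : nat)
    (H : set 'rV[R]_n) : Prop :=
  exists (a : 'rV[R]_n) (b : R), a != 0 /\ H = [set x | edot a x <= b].

(* The empty intersection is allowed: the whole space is a polyhedron. *)
Definition polyhedron (R : realType) (n : nat) (A : set 'rV[R]_n) : Prop :=
  exists (m : nat) (H : 'I_m -> set 'rV[R]_n),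
    (forall i, closed_half_space (H i)) /\ A = \bigcap_i H i.

(* Main.v *)
(** For [x] in the Voronoi cell of [p], the constraint of a point [q] reads
    [2 (x - p).(q - p) <= |q - p|^2].  Finitely many points of [P] produce the
    generators [v_j] of the direction cone, and their constraints already give
    [2 (x - p).v_j <= b_j].  By the conic Caratheodory theorem, [q - p] is a
    combination of the [v_j] with coefficients between [0] and [K |q - p|], [K]
    independent of [q]; hence [2 (x - p).(q - p) <= K (sum_j b_j) |q - p|], so
    the constraint of [q] is redundant as soon as [|q - p| >= K sum_j b_j].
    By discreteness only finitely many constraints remain. *)
Require Import Defs.
From HB Require Import structures.
From mathcomp Require Import all_boot all_order all_algebra.
From mathcomp Require Import all_classical all_reals all_analysis.
From mathcomp Require Import lra.
Import Order.TTheory GRing.Theory Num.Theory.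
Import numFieldNormedType.Exports.
Local Open Scope classical_set_scope.
Local Open Scope ring_scope.

(** * Euclidean dot product, bisectors and balls *)

Section EuclideanDotProduct.
Context {R : realType} {n : nat}.
Implicit Types (x y z p q : 'rV[R]_n) (a : R).

Lemma edotC x y : edot x y = edot y x.
Proof. by apply: eq_bigr => i _; rewrite mulrC. Qed.

Lemma edotDl x y z : edot (x + y) z = edot x z + edot y z.
Proof. by rewrite -big_split; apply: eq_bigr => i _; rewrite mxE mulrDl. Qed.

Lemma edotZl a x y : edot (a *: x) y = a * edot x y.
Proof. by rewrite [RHS]mulr_sumr; apply: eq_bigr => i _; rewrite mxE mulrA. Qed.

Lemma edotDr x y z : edot x (y + z) = edot x y + edot x z.
Proof. by rewrite edotC edotDl !(edotC x). Qed.

Lemma edotZr a x y : edot x (a *: y) = a * edot x y.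
Proof. by rewrite edotC edotZl (edotC x). Qed.

Lemma edotNl x y : edot (- x) y = - edot x y.
Proof. by rewrite -scaleN1r edotZl mulN1r. Qed.

Lemma edotNr x y : edot x (- y) = - edot x y.
Proof. by rewrite edotC edotNl (edotC x). Qed.

Lemma edot_sumr (k : nat) (w : 'I_k -> 'rV[R]_n) x :
  edot x (\sum_i w i) = \sum_i edot x (w i).
Proof.
rewrite exchange_big; apply: eq_bigr => i _.
by rewrite summxE mulr_sumr.
Qed.

Lemma edot_ge0 x : 0 <= edot x x.
Proof. by apply: sumr_ge0 => i _; rewrite -expr2 sqr_ge0. Qed.

Lemma enorm_ge0 x : 0 <= enorm x.
Proof. exact: sqrtr_ge0. Qed.

Lemma sqr_enorm x : enorm x ^+ 2 = edot x x.
Proof. by rewrite sqr_sqrtr ?edot_ge0. Qed.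

Lemma ler_enorm x y : (enorm x <= enorm y) = (edot x x <= edot y y).
Proof. by rewrite ler_sqrt ?edot_ge0. Qed.

Lemma normr_coord_le_enorm x i : `|x 0 i| <= enorm x.
Proof.
rewrite -sqrtr_sqr ler_sqrt ?edot_ge0// /edot (bigD1 i)//= -expr2 lerDl.
by apply: sumr_ge0 => j _; rewrite -expr2 sqr_ge0.
Qed.

Lemma enorm_sub_le_edot x p q :
  (enorm (x - p) <= enorm (x - q)) =
  (2 * edot (x - p) (q - p) <= enorm (q - p) ^+ 2).
Proof.
rewrite ler_enorm sqr_enorm.
have -> : x - q = (x - p) - (q - p) by rewrite opprB addrA subrK.
move: (x - p) (q - p) => u v.
rewrite !(edotDl, edotDr, edotNl, edotNr) (edotC v u).
by apply/idP/idP; lra.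
Qed.

Lemma enorm_sub_le_half_space x p q :
  (enorm (x - p) <= enorm (x - q)) =
  (edot (q - p) x <= (edot q q - edot p p) / 2).
Proof.
rewrite ler_enorm !(edotDl, edotDr, edotNl, edotNr) !(edotC _ x).
by apply/idP/idP; lra.
Qed.

Lemma ebounded_ball p (r : R) : ebounded [set q | enorm (q - p) <= r].
Proof.
(* By the parallelogram law, [|q|^2 + |q - 2p|^2 = 2 |q - p|^2 + 2 |p|^2]; the second term on the
   left is dropped. *)
exists (Num.sqrt (2 * r ^+ 2 + 2 * edot p p)) => q /= qr.
have r0 : 0 <= r by exact: le_trans (enorm_ge0 _) qr.
have : edot (q - p) (q - p) <= r ^+ 2.
  by rewrite -sqr_enorm ler_sqr ?nnegrE ?enorm_ge0.
have := edot_ge0 (q - p - p); have := edot_ge0 p.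
rewrite !(edotDl, edotDr, edotNl, edotNr) (edotC p q) => p0 d0 dr.
by rewrite ler_sqrt; nra.
Qed.

Lemma enorm_mulmx_le {k : nat} (A : 'M[R]_(n, k)) x i :
  (x *m A) 0 i <= (\sum_j \sum_l `|A j l|) * enorm x.
Proof.
rewrite mxE mulr_suml; apply: ler_sum => j _.
rewrite (le_trans (ler_norm _))// normrM mulrC.
apply: ler_pM => //; last exact: normr_coord_le_enorm.
by rewrite (bigD1 i)//= lerDl; apply: sumr_ge0.
Qed.

End EuclideanDotProduct.

(** * Conic Caratheodory theorem and recovery of coefficients *)

Section ConicCaratheodory.
Context {R : realFieldType} {k n : nat} (M : 'M[R]_(k, n)).

Definition rv_support (l : 'rV[R]_k) : {set 'I_k} := [set i | l 0 i != 0]%SET.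

Lemma rv_supportN (l : 'rV[R]_k) : rv_support (- l) = rv_support l.
Proof. by apply/setP => i; rewrite !inE mxE oppr_eq0. Qed.

(* Move along the relation [m] until the first coefficient of [l] vanishes. *)
Lemma conic_shrink_support (l m : 'rV[R]_k) :
    (forall i, 0 <= l 0 i) -> m *m M = 0 ->
    rv_support m \subset rv_support l -> (exists i, 0 < m 0 i) ->
  exists l' : 'rV[R]_k, [/\ forall i, 0 <= l' 0 i, l' *m M = l *m M &
    (#|rv_support l'| < #|rv_support l|)%N].
Proof.
move=> l0 mM sml [i1 mi1].
case: (@arg_minP _ _ _ i1 (fun i => 0 < m 0 i) (fun i => l 0 i / m 0 i) mi1).
move=> i0 mi0 mini; set t := l 0 i0 / m 0 i0 in mini.
have t0 : 0 <= t by rewrite divr_ge0 ?l0// ltW.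
have tl i : 0 <= l 0 i - t * m 0 i.
  have [mi|mi] := ltP 0 (m 0 i).
    by rewrite subr_ge0 -ler_pdivlMr//; exact: mini.
  by rewrite subr_ge0 (le_trans _ (l0 i))// mulr_ge0_le0.
exists (l - t *: m); split.
- by move=> i; rewrite !mxE.
- by rewrite mulmxBl -scalemxAl mM scaler0 subr0.
apply: proper_card; apply/properP; split.
  apply/fintype.subsetP => i; rewrite !inE !mxE; apply: contraNneq => li.
  have : i \notin rv_support m.
    by apply/negP => /(fintype.subsetP sml); rewrite inE li eqxx.
  by rewrite inE negbK => /eqP ->; rewrite li mulr0 subr0.
exists i0.
  by apply: (fintype.subsetP sml); rewrite inE gt_eqF.
by rewrite inE !mxE /t divfK ?subrr ?eqxx// gt_eqF.
Qed.

(** Strong induction on the size of the support: a nonzero relation inside the support allows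
    shrinking it. *)
Lemma conic_caratheodory (l : 'rV[R]_k) : (forall i, 0 <= l 0 i) ->
  exists l' : 'rV[R]_k, [/\ forall i, 0 <= l' 0 i, l' *m M = l *m M &
    forall m : 'rV[R]_k, m *m M = 0 -> rv_support m \subset rv_support l' ->
      m = 0].
Proof.
have [s] := ubnP #|rv_support l|; elim: s l => // s IHs l ls l0.
have [indep|] := pselect (forall m : 'rV[R]_k, m *m M = 0 ->
    rv_support m \subset rv_support l -> m = 0); first by exists l.
move=> /existsNP[m /not_implyP[mM /not_implyP[sml /eqP m0]]].
have [l' [l'0 l'M l's]] : exists l' : 'rV[R]_k, [/\ forall i, 0 <= l' 0 i,
    l' *m M = l *m M & (#|rv_support l'| < #|rv_support l|)%N].
  have [i mi] : exists i, m 0 i != 0.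
    by apply/existsP; rewrite -negb_forall; apply: contra m0 => /forallP m0;
       apply/eqP/rowP => i; rewrite mxE; apply/eqP.
  (* Shrinking needs a positive coefficient; [m] or [- m] has one. *)
  have [mi0|mi0] := ltP 0 (m 0 i).
    by apply: (conic_shrink_support l m) => //; exists i.
  apply: (conic_shrink_support l (- m)) => //.
  - by rewrite mulNmx mM oppr0.
  - by rewrite rv_supportN.
  - by exists i; rewrite mxE oppr_gt0 lt_neqAle mi.
have [|//|l2 [l20 l2M indep]] := IHs l'; first exact: leq_trans l's _.
by exists l2; split => //; rewrite l2M.
Qed.

(* When the rows of [M] indexed by [S] are independent, this matrix recovers
   the coefficients from the combination. *)
Definition coef_mx (S : {set 'I_k}) : 'M[R]_(n, k) :=
  let D := diag_mx (\row_i (i \in S)%:R) in pinvmx (D *m M) *m D.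

Lemma coef_mxK (l : 'rV[R]_k) :
    (forall m : 'rV[R]_k, m *m M = 0 -> rv_support m \subset rv_support l ->
      m = 0) ->
  l *m M *m coef_mx (rv_support l) = l.
Proof.
move=> indep; rewrite /coef_mx; set D := diag_mx _.
have DE (m : 'rV[R]_k) i : (m *m D) 0 i = m 0 i * (i \in rv_support l)%:R.
  by rewrite mul_mx_diag !mxE.
have lD : l *m D = l.
  apply/rowP => i; rewrite DE inE.
  by have [->|_] := eqVneq (l 0 i) 0; rewrite ?mul0r ?mulr1.
(* Both sides are supported in [rv_support l] and have the same image under [M], since
   [l *m M = l *m D *m M] lies in the row space of [D *m M]. Independence then makes their
   difference zero. *)
apply/eqP; rewrite -subr_eq0; apply/eqP/indep.
  rewrite mulmxBl mulmxA -(mulmxA _ D M) mulmxKpV ?subrr//.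
  by rewrite -{1}lD -mulmxA submxMl.
apply/fintype.subsetP => i; rewrite inE; apply: contraNT => li.
rewrite mulmxA mxE DE (negbTE li) mulr0 add0r mxE oppr_eq0.
by move: li; rewrite inE negbK.
Qed.

End ConicCaratheodory.

(** * Reduction of the Voronoi cell to finitely many constraints *)

Section Voronoi.
Context {R : realType} {n : nat}.
Implicit Types (P : set 'rV[R]_n) (p q x : 'rV[R]_n).

Lemma sub_cone (S : set 'rV[R]_n) : S `<=` cone S.
Proof.
move=> u Su; exists 1%N, (fun=> u), (fun=> 1); split => //.
by rewrite big_ord1 scale1r.
Qed.

(** For an independent support [S], the coefficients depend linearly on [u] through [coef_mx M S].
    There are finitely many [S], so summing the entrywise norms of these matrices gives a uniform
    [K]. *)
Lemma cone_range_bounded_coef {k : nat} (v : 'I_k -> 'rV[R]_n) :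
  exists2 K : R, 0 <= K & forall u, cone (range v) u ->
    exists c : 'I_k -> R,
      [/\ forall j, 0 <= c j, forall j, c j <= K * enorm u &
          u = \sum_j c j *: v j].
Proof.
pose M : 'M[R]_(k, n) := \matrix_(j < k) v j.
pose norm1 S := \sum_i \sum_j `|coef_mx M S i j|.
have norm1_ge0 S : 0 <= norm1 S by do 2![apply: sumr_ge0 => ? _].
exists (\sum_S norm1 S); first exact: sumr_ge0.
move=> u [m [w [a [wv a0 ->]]]].
have /choice[f fw] i : exists j, v j = w i.
  by have [j _ <-] := wv i; exists j.
(* A generator may occur several times in the combination; its coefficients are added up. *)
pose l : 'rV[R]_k := \row_j \sum_(i | f i == j) a i.
have lM : l *m M = \sum_i a i *: w i.
  rewrite mulmx_sum_row (partition_big f xpredT)//=; apply: eq_bigr => j _.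
  rewrite rowK mxE scaler_suml; apply: eq_bigr => i /eqP <-.
  by rewrite fw.
rewrite -lM.
have [|l' [l'0 <- indep]] := conic_caratheodory M l.
  by move=> j; rewrite mxE sumr_ge0.
exists (l' 0); split => // [j|]; last first.
  by rewrite mulmx_sum_row; apply: eq_bigr => j _; rewrite rowK.
rewrite -[in X in X <= _](coef_mxK M l' indep).
apply: le_trans (enorm_mulmx_le _ _ _) _.
rewrite ler_wpM2r ?enorm_ge0// (bigD1 (rv_support l'))//= lerDl.
exact: sumr_ge0.
Qed.

Definition local_voronoi_cell P p (r : R) : set 'rV[R]_n :=
  voronoi_cell (P `&` [set q | enorm (q - p) <= r]) p.

Lemma local_voronoi_cell_le P p (r s : R) : r <= s ->
  local_voronoi_cell P p s `<=` local_voronoi_cell P p r.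
Proof.
by move=> rs x xs q [Pq qr]; apply: xs; split => //; exact: le_trans qr rs.
Qed.

Lemma direction_cone_edot_le P p u : direction_cone P p u ->
  exists r b : R, forall x, local_voronoi_cell P p r x ->
    2 * edot (x - p) u <= b.
Proof.
move=> [m [w [a [wP a0 ->]]]].
(* This radius dominates every [enorm (w i)], so the constraint of each [p + w i] is available. *)
exists (\sum_i enorm (w i)), (\sum_i a i * enorm (w i) ^+ 2) => x xV.
rewrite edot_sumr mulr_sumr; apply: ler_sum => i _.
rewrite edotZr mulrCA ler_wpM2l//.
have [q Pq qw] := wP i; rewrite -qw -enorm_sub_le_edot; apply: xV; split => //=.
rewrite qw (bigD1 i)//= lerDl; apply: sumr_ge0 => j _; exact: enorm_ge0.
Qed.

Lemma voronoi_cell_local P p : finitely_generated_cone (direction_cone P p) ->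
  exists r : R, voronoi_cell P p = local_voronoi_cell P p r.
Proof.
move=> [k [v Cv]].
have vC j : direction_cone P p (v j) by rewrite Cv; apply: sub_cone; exists j.
have /choice[r /choice[b vb]] j := direction_cone_edot_le P p (v j) (vC j).
have [K K0 hK] := cone_range_bounded_coef v.
(* The term [K * B] makes distant constraints redundant; the other makes [r0] at least every [r j].
   Absolute values are taken since [b j] and [r j] may be negative. *)
pose B := \sum_j `|b j|; pose r0 := K * B + \sum_j `|r j|.
have rr0 j : r j <= r0.
  rewrite (le_trans (ler_norm _))// /r0 (bigD1 j)//= addrCA lerDl.
  by rewrite addr_ge0// ?mulr_ge0// ?sumr_ge0.
exists r0; apply/seteqP; split => x xV q; first by case=> Pq _; exact: xV.
move=> Pq; have [qr|rq] := leP (enorm (q - p)) r0; first exact: xV.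
rewrite enorm_sub_le_edot.
have [|c [c0 cK qE]] := hK (q - p).
  by rewrite -Cv; apply: sub_cone; exists q.
apply: (@le_trans _ _ (K * B * enorm (q - p))).
  rewrite {1}qE edot_sumr mulr_sumr mulrAC mulr_sumr; apply: ler_sum => j _.
  rewrite edotZr mulrCA (@le_trans _ _ (c j * `|b j|))//.
    rewrite ler_wpM2l// (le_trans _ (ler_norm _))//.
    by apply: vb; exact: local_voronoi_cell_le (rr0 j) _ xV.
  by rewrite ler_wpM2r.
rewrite expr2 ler_wpM2r ?enorm_ge0// (le_trans _ (ltW rq))// lerDl.
exact: sumr_ge0.
Qed.

Lemma finite_voronoi_cell_polyhedron P p : finite_set P ->
  polyhedron (voronoi_cell P p).
Proof.
(* The point [p] is removed: its constraint is trivial and has normal vector [0], hence defines no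
   half space. *)
move=> /(finite_setD [set p]) /finite_seqP[s Ps].
have sP q : q \in s <-> P q /\ q <> p.
  have -> : q \in s <-> [set` s] q by [].
  by rewrite -Ps.
exists (size s), (fun i => [set x | edot (s`_i - p) x <=
  (edot s`_i s`_i - edot p p) / 2]); split => [i|].
  exists (s`_i - p), ((edot s`_i s`_i - edot p p) / 2); split => //.
  have /sP[_ /eqP] : s`_i \in s by exact: mem_nth.
  by rewrite subr_eq0.
apply/seteqP; split => x xV.
  move=> i _ /=; rewrite -enorm_sub_le_half_space; apply: xV.
  by have /sP[] : s`_i \in s by exact: mem_nth.
move=> q Pq; have [->//|/eqP qp] := eqVneq q p.
have qs : q \in s by apply/sP.
have qi : (index q s < size s)%N by rewrite index_mem.
have := xV (Ordinal qi) Logic.I; rewrite /= nth_index//.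
by rewrite -enorm_sub_le_half_space.
Qed.

End Voronoi.

Theorem theorem4p3 (R : realType) (n : nat) (P : set 'rV[R]_n) (p : 'rV[R]_n)
    (hdiscrete : discrete_point_set P)
    (hp : (P `&` boundary (convex_hull P)) p)
    (hfg : finitely_generated_cone (direction_cone P p)) :
  polyhedron (voronoi_cell P p).
Proof.
have [r ->] := voronoi_cell_local P p hfg.
exact/finite_voronoi_cell_polyhedron/hdiscrete/ebounded_ball.
Qed.
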